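(* Let $\mathcal G$ be a connected compact metric graph with total length $|\mathcal G|=L$, let $\mathcal V^D\subseteq\mathcal V$ be a nonempty set of degree-one vertices, and let $1<r<p<\infty$. Then $$T_p(\mathcal G,\mathcal V^D)^{1/p}\le L^{1/r-1/p}\,T_r(\mathcal G,\mathcal V^D)^{1/r}.$$ Equivalently, the map $p\mapsto L^{1/p}\,T_p(\mathcal G,\mathcal V^D)^{1/p}$ is non-increasing on $(1,\infty)$.
   Context: A compact metric graph $\mathcal G$ is obtained from a finite combinatorial graph with vertex set $\mathcal V$ and finite edge set $\mathcal E$ by identifying the endpoints of compact intervals $[0,\ell_e]$, $\ell_e>0$, $e\in\mathcal E$, according to the graph structure; $|\mathcal G|=\sum_{e}\ell_e$. $\mathcal E_v$ is the set of edges incident with $v$ (a loop at $v$ counted twice, once for each endpoint) and $\deg(v)=|\mathcal E_v|$. Set $\mathcal V^N=\mathcal V\setminus\mathcal V^D$. $u_e$ denotes the restriction of $u$ to $e$. For $1<p<\infty$, $W^{1,p}(\mathcal G)$ is the space of $u:\mathcal G\to\mathbb R$ with $u|_e\in W^{1,p}(0,\ell_e)$ for all $e\in\mathcal E$ and $u$ continuous at every vertex; $W^{1,p}_{\mathcal V^D}(\mathcal G)=\{u\in W^{1,p}(\mathcal G): u(v)=0\ \forall v\in\mathcal V^D\}$. Integrals over $\mathcal G$ are sums of integrals over edges. For $1<p<\infty$, the $p$-torsion function $w_p$ is the unique function in $W^{1,p}_{\mathcal V^D}(\mathcal G)$ with $-(|w_{p,e}'|^{p-2}w_{p,e}')'=1$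 on each edge $e$, $w_p(v)=0$ for $v\in\mathcal V^D$, and $\sum_{e\in\mathcal E_v}|w_{p,e}'(v)|^{p-2}\partial_{\nu_e}w_{p,e}(v)=0$ for $v\in\mathcal V^N$, where $\partial_{\nu_e}$ is the derivative at $v$ in the outward direction along $e$ (pointing from $v$ into $e$). Equivalently, $\int_{\mathcal G}|w_p'|^{p-2}w_p'\phi'\,dx=\int_{\mathcal G}\phi\,dx$ for all $\phi\in W^{1,p}_{\mathcal V^D}(\mathcal G)$. The $p$-torsional rigidity is $T_p(\mathcal G,\mathcal V^D)=\bigl(\int_{\mathcal G}w_p\,dx\bigr)^{p-1}$. *)

(* Defs.v *)
From HB Require Import structures.
From mathcomp Require Import all_boot all_order all_algebra.
From mathcomp Require Import all_classical all_reals all_analysis.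

Set Implicit Arguments.
Unset Strict Implicit.
Unset Printing Implicit Defensive.

Import Order.TTheory GRing.Theory Num.Theory.
Import numFieldNormedType.Exports.

Local Open Scope ring_scope.
Local Open Scope classical_set_scope.

Section OneDimension.
Context {R : realType}.
Implicit Types (l p : R) (u g phi : R -> R).

Definition in_Lp p l u : Prop :=
  measurable_fun `]0, l[ u /\
  (\int[lebesgue_measure]_(x in `]0%R, l[) (`|u x| `^ p)%:E < +oo)%E.

Definition test_function l phi : Prop :=
  [/\ forall n x, derivable (derive1n n phi) x 1,
      compact (closure [set x | phi x != 0])
    & closure [set x | phi x != 0] `<=` `]0, l[].

Definition weak_derivative l u g : Prop :=
  forall phi, test_function l phi ->
    \int[lebesgue_measure]_(x in `]0, l[) (u x * derive1 phi x) =
    - \int[lebesgue_measure]_(x in `]0, l[) (g x * phi x).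

(* The function itself, not its class modulo null sets: [u] is required to be
   the representative that is continuous up to the endpoints 0 and l. *)
Definition sobolev1 p l u : Prop :=
  [/\ {within `[0, l], continuous u}, in_Lp p l u
    & exists2 g, in_Lp p l g & weak_derivative l u g].

(* |s|^(p-2) s. Its value at s = 0 is 0 for every p, including p < 2, since
   [0 `^ a] is 0 for a != 0 and 1 for a = 0. *)
Definition pflux p (s : R) : R := `|s| `^ (p - 2) * s.

End OneDimension.

(* Loops and multiple edges are allowed. Edge [e] is the interval
   [0, edge_length e], with 0 at the vertex [edge_end e false] and
   [edge_length e] at the vertex [edge_end e true]. *)
Record metric_graph (R : realType) := MetricGraph {
  vertex : finType;
  edge : finType;
  edge_end : edge -> bool -> vertex;
  edge_length : edge -> R;
  edge_length_gt0 : forall e, 0 < edge_length e }.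

Section MetricGraph.
Context {R : realType} (G : metric_graph R).
Implicit Types (v : vertex G) (e : edge G) (p : R).

Definition adjacent : rel (vertex G) := fun v w =>
  [exists e : edge G, exists b : bool,
    (edge_end e b == v) && (edge_end e (~~ b) == w)].

Definition connected_graph : Prop := forall v w, connect adjacent v w.

(* The pairs (edge, endpoint) at [v], so that a loop at [v] occurs twice. *)
Definition incident v : {set edge G * bool} :=
  [set h : edge G * bool | edge_end h.1 h.2 == v].

Definition degree v : nat := #|incident v|.

Definition total_length : R := \sum_(e : edge G) edge_length e.

(* A function on G is given by its values at the vertices and by its
   restrictions to the edges. The latter are total functions on R, of which
   only the values on [0, edge_length e] are meaningful. *)
Definition graph_fun : Type :=
  ((vertex G -> R) * (edge G -> R -> R))%type.

Definition at_vertex (u : graph_fun) : vertex G -> R := u.1.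
Definition on_edge (u : graph_fun) : edge G -> R -> R := u.2.

Definition end_coord e (b : bool) : R := if b then edge_length e else 0.

(* Together with the continuity of each [on_edge u e] on the closed interval,
   the second clause is the continuity of [u] at the vertices. *)
Definition W1p p (u : graph_fun) : Prop :=
  (forall e, sobolev1 p (edge_length e) (on_edge u e)) /\
  (forall e b, on_edge u e (end_coord e b) = at_vertex u (edge_end e b)).

Definition W1p_dir p (D : {set vertex G}) (u : graph_fun) : Prop :=
  W1p p u /\ (forall v, v \in D -> at_vertex u v = 0).

Definition integral_graph (u : graph_fun) : R :=
  \sum_(e : edge G)
    \int[lebesgue_measure]_(x in `[0, edge_length e]) on_edge u e x.

(* One-sided derivative of u_e at the endpoint [h.2] of [e = h.1], in the
   direction pointing from the vertex into the edge. *)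
Definition normal_derivative (u : graph_fun) (h : edge G * bool) : R :=
  let c := end_coord h.1 h.2 in
  lim ((on_edge u h.1 (c + (-1) ^+ h.2 * t) - on_edge u h.1 c) / t
         @[t --> 0^'+]).

(* The limits in [normal_derivative] exist for every [u] that satisfies the
   first two clauses. *)
Definition is_torsion_function p (D : {set vertex G}) (u : graph_fun) : Prop :=
  [/\ W1p_dir p D u,
      forall e x, x \in `]0, edge_length e[ ->
        derivable (on_edge u e) x 1 /\
        is_derive x 1 (fun y => - pflux p (derive1 (on_edge u e) y)) 1
    & forall v, v \notin D ->
        \sum_(h in incident v) pflux p (normal_derivative u h) = 0].

(* For p > 1, G connected and D nonempty, [is_torsion_function] has a solution
   and determines it on G; the choice only concerns the meaningless values of [on_edge]
   outside the edges. *)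
Definition torsion_function p (D : {set vertex G}) : graph_fun :=
  xget ((fun=> 0, fun _ _ => 0) : graph_fun)
       [set u | is_torsion_function p D u].

Definition torsional_rigidity p (D : {set vertex G}) : R :=
  integral_graph (torsion_function p D) `^ (p - 1).

End MetricGraph.

Arguments connected_graph {R} G.
Arguments total_length {R} G.
Arguments torsional_rigidity {R} G p D.

(* Main.v *)
(* Let q = p/(p-1). The flux F = |w'|^(p-2) w' of the p-torsion function w
   satisfies -F' = 1 on the edges and the Kirchhoff conditions off the Dirichlet
   vertices. Integration by parts gives, for every other such flux H,
   \int w = \int H w' = \int H |F|^(q-2) F, so \int w = \int |F|^q, and by
   Young's inequality F minimises the L^q norm among these fluxes. Hence
   T_p^(1/p) is the least L^q norm of a flux, a problem whose constraints do not
   depend on p, and the power mean inequality between q(p) < q(r) concludes.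
   On an edge a flux is c - x for a constant c, so everything is explicit in the
   finitely many constants c_e. The r-torsion function must be shown to exist
   (otherwise its chosen value would be junk): minimise the
   L^q energy over the affine space of fluxes; the Lagrange multipliers are the
   values of w at the vertices. *)
Require Import Defs.
From HB Require Import structures.
From mathcomp Require Import all_boot all_order all_algebra.
From mathcomp Require Import all_classical all_reals all_analysis.
From mathcomp Require Import measurable_realfun.
From mathcomp Require Import ring lra.
Import Order.TTheory GRing.Theory Num.Theory.
Import numFieldNormedType.Exports.
Local Open Scope ring_scope.
Local Open Scope classical_set_scope.

Set Implicit Arguments.
Unset Strict Implicit.
Unset Printing Implicit Defensive.

(** * The power map [pflux], its inverse and its antiderivatives *)

Section PowerFlux.
Context {R : realType}.
Implicit Types (a c p q s t x y : R).

(** For 1 < q, the antiderivative of [pflux q] that vanishes at 0. *)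
Definition pprim q s : R := `|s| `^ q / q.

(** For 1 < q, the antiderivative of [pprim q] that vanishes at 0; it is odd. *)
Definition pprim2 q s : R := pprim q s * s / (q + 1).

Lemma pfluxN q s : pflux q (- s) = - pflux q s.
Proof. by rewrite /pflux normrN mulrN. Qed.

Lemma normr_pflux q s : 1 < q -> `|pflux q s| = `|s| `^ (q - 1).
Proof.
move=> q1; rewrite /pflux normrM (ger0_norm (powR_ge0 _ _)).
rewrite mulrC (_ : q - 2 = (q - 1) - 1); last by ring.
by rewrite mulr_powRB1// subr_gt0.
Qed.

Lemma pflux_mulr q s : 1 < q -> pflux q s * s = `|s| `^ q.
Proof.
move=> q1; rewrite /pflux (_ : q - 2 = (q - 1) - 1); last by ring.
rewrite -mulrA -expr2 -real_normK ?num_real// expr2 mulrC -mulrA.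
by rewrite !mulr_powRB1 ?subr_gt0//; lra.
Qed.

(** Composing gives s times |s| to the power (q-1)(p-2) + (q-2) = pq - p - q, and this exponent is 0
    for conjugate p and q. *)
Lemma pfluxK p q s : 1 < p -> p^-1 + q^-1 = 1 -> pflux p (pflux q s) = s.
Proof.
move=> p1 pq; have p0 : p != 0 by rewrite gt_eqF//; lra.
(* As the inverse of 0 is 0, the hypothesis with q = 0 reads p^-1 = 1, against 1 < p. *)
have [q0|q0] := eqVneq q 0.
  by move: pq; rewrite q0 invr0 addr0 => /(congr1 GRing.inv); rewrite invrK invr1; lra.
have pqE : p * q = p + q.
  by rewrite -[LHS]mulr1 -pq; field; rewrite p0 q0.
have q1 : 1 < q by nra.
have [->|s0] := eqVneq s 0; first by rewrite /pflux !mulr0.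
rewrite {1}/pflux normr_pflux// /pflux mulrA -powRrM -powRD; last first.
  by rewrite normr_eq0 s0 implybT.
rewrite (_ : _ + _ = 0); first by rewrite powRr0 mul1r.
by move: pqE; lra.
Qed.

Lemma continuous_normr_powR_neq0 a x : x != 0 ->
  {for x, continuous (fun s : R => `|s| `^ a)}.
Proof.
move=> x0.
have D : {for `|x|, continuous (fun y : R => y `^ a)}.
  apply: differentiable_continuous; apply/derivable1_diffP.
  by apply: derivable_powR; rewrite in_itv/= andbT normr_gt0.
exact: (cvg_comp _ _ (@norm_continuous _ _ x) D).
Qed.

Lemma continuous_normr_powR a : 0 < a -> continuous (fun s : R => `|s| `^ a).
Proof.
move=> a0 x; have [->|x0] := eqVneq x 0.
  rewrite /continuous_at normr0 powR0 ?gt_eqF//.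
  apply/cvgr0Pnorm_lt => e e0.
  have d0 : 0 < e `^ a^-1 by rewrite powR_gt0.
  near=> t; rewrite ger0_norm ?powR_ge0//.
  have te : `|t| < e `^ a^-1.
    by near: t; apply: (@cvgr0_norm_lt _ _ _ (nbhs 0) _ id) => //; exact: cvg_id.
  rewrite -[ltRHS](powRr1 (ltW e0)) -(mulVf (lt0r_neq0 a0)) powRrM.
  by apply: gt0_ltr_powR => //; rewrite nnegrE ?normr_ge0 ?powR_ge0.
exact: continuous_normr_powR_neq0.
Unshelve. all: by end_near. Qed.

Lemma continuous_pflux q : 1 < q -> continuous (pflux q).
Proof.
move=> q1 x; have [->|x0] := eqVneq x 0.
  rewrite /continuous_at {2}/pflux mulr0.
  apply: norm_cvg0; under eq_fun do rewrite normr_pflux//.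
  have q10 : 0 < q - 1 by rewrite subr_gt0.
  have := @continuous_normr_powR _ q10 0.
  by rewrite /continuous_at normr0 powR0 ?gt_eqF.
apply: cvgM; last exact: cvg_id.
exact: continuous_normr_powR_neq0.
Qed.

Lemma is_derive_pprim_gt0 q s : 1 < q -> 0 < s ->
  is_derive s 1 (pprim q) (pflux q s).
Proof.
move=> q1 s0.
apply: (@near_eq_is_derive _ _ _ (q^-1 *: (fun t : R => t `^ q))).
  near=> t; rewrite /pprim gtr0_norm; first exact: mulrC.
  by near: t; exact: lt_nbhsr.
have D := is_derive1_powR q s0; apply: is_derive_eq.
rewrite /pflux gtr0_norm// /GRing.scale/= mulrA mulVf ?mul1r; last by rewrite gt_eqF//; lra.
by rewrite (_ : q - 2 = (q - 1) - 1) 1?mulrC ?mulr_powRB1// ?subr_gt0//; [exact: ltW|ring].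
Unshelve. all: by end_near. Qed.

Lemma is_derive_pprim q s : 1 < q -> is_derive s 1 (pprim q) (pflux q s).
Proof.
move=> q1; have q0 : q != 0 by rewrite gt_eqF//; lra.
have [s0|s0|->] := ltgtP s 0; last first.
(* At 0 the difference quotient is [pflux q h / q], which tends to 0 by continuity of [pflux]. *)
- have D : h^-1 *: ((pprim q \o shift 0) (h *: (1 : R)) - pprim q 0) @[h --> 0^'] --> (0 : R).
    have F : q^-1 * pflux q h @[h --> 0^'] --> q^-1 * pflux q 0.
      by apply: cvgMl_tmp; apply: cvg_within_filter; exact: continuous_pflux.
    rewrite {2}/pflux !mulr0 in F; apply: cvg_trans F.
    apply: near_eq_cvg; near=> h.
    have h0 : h != 0 by near: h; exact: nbhs_dnbhs_neq.
    rewrite /pprim /= addr0 normr0 powR0// mul0r subr0 /GRing.scale/= mulr1.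
    by rewrite -pflux_mulr//; field; rewrite h0 q0.
  rewrite /pflux mulr0; apply: DeriveDef; last exact: cvg_lim D.
  by apply/cvg_ex; exists 0.
- exact: is_derive_pprim_gt0.
- have := @is_derive_pprim_gt0 q (- s) q1; rewrite oppr_gt0 => /(_ s0) D.
  rewrite (_ : pprim q = pprim q \o -%R); last first.
    by apply/funext => t; rewrite /= /pprim normrN.
  rewrite -[pflux q s]opprK -pfluxN -mulrN1.
  exact: is_derive1_comp.
Unshelve. all: by end_near. Qed.

Lemma pprimE q s : 1 < q -> pflux q s * s = q * pprim q s.
Proof. by move=> q1; rewrite pflux_mulr// /pprim mulrC divfK// gt_eqF//; lra. Qed.

Lemma is_derive_pprim2 q s : 1 < q -> is_derive s 1 (pprim2 q) (pprim q s).
Proof.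
move=> q1; have D := is_derive_pprim s q1.
rewrite (_ : pprim2 q = (q + 1)^-1 *: (pprim q * id)); last first.
  by apply/funext => t; rewrite /pprim2 mulrC.
apply: is_derive_eq.
rewrite /GRing.scale/= mulr1 [s * _]mulrC pprimE//.
by field; rewrite gt_eqF//; lra.
Qed.

Lemma pprim_ge0 q s : 1 < q -> 0 <= pprim q s.
Proof. by move=> q1; rewrite divr_ge0 ?powR_ge0//; lra. Qed.

Lemma continuous_pprim q : 1 < q -> continuous (pprim q).
Proof.
move=> q1 s; apply/differentiable_continuous/derivable1_diffP.
by case: (is_derive_pprim s q1).
Qed.

Lemma continuous_pprim2 q : 1 < q -> continuous (pprim2 q).
Proof.
move=> q1 s; apply/differentiable_continuous/derivable1_diffP.
by case: (is_derive_pprim2 s q1).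
Qed.

(** Stands in for monotonicity of the integral: pointwise inequalities are integrated over an edge
    through explicit antiderivatives, by the mean value theorem. *)
Lemma le_itv_diff (f g df dg : R -> R) a b : a <= b ->
  (forall x, is_derive x 1 f (df x)) -> (forall x, is_derive x 1 g (dg x)) ->
  (forall x, df x <= dg x) -> f b - f a <= g b - g a.
Proof.
move=> ab Df Dg dfg.
have D x : is_derive x 1 (g - f) (dg x - df x) by apply: is_deriveB.
have cgf : {within `[a, b], continuous (g - f)}.
  by apply: continuous_subspaceT => x; apply: differentiable_continuous;
  apply/derivable1_diffP; case: (D x).
have [c _ E] := MVT_segment ab (fun x _ => D x) cgf.
suff : 0 <= (g b - f b) - (g a - f a) by lra.
by have -> : (g b - f b) - (g a - f a) = _ := E; rewrite mulr_ge0 ?subr_ge0.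
Qed.

End PowerFlux.

(** * Young's inequality integrated along one edge *)

Section EdgeEnergy.
Context {R : realType}.
Implicit Types (c d l p q s t x M : R).

(* q times this quantity is the integral of |c - x|^q over [0, l]. *)
Definition edge_energy q c l : R := pprim2 q c - pprim2 q (c - l).

(** Young's inequality with exponents q and q/(q-1), since [pflux q c] has absolute value
    |c|^(q-1). *)
Lemma young_pflux q d c : 1 < q ->
  d * pflux q c <= pprim q d + (q - 1) * pprim q c.
Proof.
move=> q1; apply: (@le_trans _ _ (`|d| * `|c| `^ (q - 1))).
  by rewrite -normr_pflux// -normrM ler_norm.
have q0 : 0 < q by lra.
have q10 : 0 < q - 1 by lra.
have := @conjugate_powR R `|d| (`|c| `^ (q - 1)) q (q / (q - 1)).
rewrite normr_ge0 powR_ge0 divr_gt0// => /(_ isT isT q0 isT).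
rewrite -powRrM (_ : (q - 1) * (q / (q - 1)) = q); last by field; rewrite gt_eqF.
rewrite invf_div (_ : q^-1 + (q - 1) / q = 1); last by field; rewrite gt_eqF.
by move=> /(_ erefl) /le_trans; apply; rewrite /pprim lerD2l mulrCA.
Qed.

Lemma is_derive_cstB c x : is_derive x 1 (fun y => c - y) (- 1).
Proof.
apply: (@is_derive_eq _ _ _ _ _ _ _ _ (is_deriveB (is_derive_cst c x 1) (is_derive_id x 1))).
exact: sub0r.
Qed.

Lemma is_derive_flipped (f : R -> R) c x df : is_derive (c - x) 1 f df ->
  is_derive x 1 (fun y => f (c - y)) (- df).
Proof.
move=> Df; rewrite -mulrN1.
exact: (@is_derive1_comp _ f (fun y => c - y) x df _ Df (is_derive_cstB c x)).
Qed.

(** This is [young_pflux] integrated for the fluxes d - x and c - x. Integrating the product by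
    parts yields the left-hand side minus one energy of c, which turns the factor q - 1 into q. *)
Lemma edge_energy_dual q c d l : 1 < q -> 0 <= l ->
  d * pprim q c - (d - l) * pprim q (c - l) <=
  edge_energy q d l + q * edge_energy q c l.
Proof.
move=> q1 l0.
pose f y := pprim2 q (c - y) - (d - y) * pprim q (c - y).
pose g y := - pprim2 q (d - y) - (q - 1) * pprim2 q (c - y).
have Df x : is_derive x 1 f ((d - x) * pflux q (c - x)).
  have D1 := is_derive_flipped (is_derive_pprim2 (c - x) q1).
  have D2 := is_derive_flipped (is_derive_pprim (c - x) q1).
  apply: (@is_derive_eq _ _ _ _ _ _ _ _ (is_deriveB D1 (is_deriveM (is_derive_cstB d x) D2))).
  by rewrite /GRing.scale/=; ring.
have Dg x : is_derive x 1 g (pprim q (d - x) + (q - 1) * pprim q (c - x)).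
  have D1 := is_derive_flipped (is_derive_pprim2 (d - x) q1).
  have D2 := is_derive_flipped (is_derive_pprim2 (c - x) q1).
  apply: (@is_derive_eq _ _ _ _ _ _ _ _ (is_deriveB (is_deriveN D1) (is_deriveZ (q - 1) D2))).
  by rewrite /GRing.scale/=; ring.
have := le_itv_diff l0 Df Dg (fun x => young_pflux _ _ q1).
by rewrite /f /g /edge_energy !subr0; lra.
Qed.

(** The equality case d = c of [edge_energy_dual]. *)
Lemma edge_energy_self q c l : 1 < q ->
  c * pprim q c - (c - l) * pprim q (c - l) = (q + 1) * edge_energy q c l.
Proof.
move=> q1; rewrite /edge_energy /pprim2; field.
by rewrite gt_eqF//; lra.
Qed.

(** Young's inequality for |t|^q / M and 1 with exponents s/q and s/(s-q), multiplied by M. Choosing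
    M later as the mean of |flux|^q over the graph yields the power mean inequality. *)
Lemma young_pprim q s M t : 0 < q -> q < s -> 0 < M ->
  q * pprim q t <= (M `^ (1 - s / q)) * q * pprim s t + M * (1 - q / s).
Proof.
move=> q0 qs M0.
have s0 : 0 < s by lra.
have sq0 : 0 < s - q by lra.
have := @conjugate_powR R (`|t| `^ q / M) 1 (s / q) (s / (s - q)).
rewrite !divr_ge0 ?powR_ge0 ?(ltW M0)// !divr_gt0//.
rewrite !invf_div (_ : q / s + (s - q) / s = 1); last by field; rewrite gt_eqF.
move=> /(_ isT ler01 isT isT erefl).
rewrite powR1 mulr1 mul1r powRM ?powR_ge0 ?invr_ge0 ?(ltW M0)// -powRrM.
rewrite (_ : q * (s / q) = s); last by field; rewrite gt_eqF.
rewrite -(ler_pM2l M0) => H.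
rewrite /pprim (_ : q * (`|t| `^ q / q) = M * (`|t| `^ q / M)); last first.
  by field; rewrite !gt_eqF.
apply: (le_trans H); rewrite le_eqVlt; apply/orP; left; apply/eqP.
rewrite powRD; last by rewrite (lt0r_neq0 M0) implybT.
rewrite powRr1 ?(ltW M0)// powRN -powR_inv1 ?(ltW M0)// -powRrM mulN1r powRN.
field.
by rewrite !gt_eqF// powR_gt0.
Qed.

Lemma edge_energy_young q s M c l : 1 < q -> q < s -> 0 < M -> 0 <= l ->
  q * edge_energy q c l <=
  (M `^ (1 - s / q)) * q * edge_energy s c l + M * (1 - q / s) * l.
Proof.
move=> q1 qs M0 l0; have s1 : 1 < s by lra.
set m := M `^ _.
pose f y := q * - pprim2 q (c - y).
pose g y := (m * q) * - pprim2 s (c - y) + M * (1 - q / s) * y.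
have Df x : is_derive x 1 f (q * pprim q (c - x)).
  have D1 := is_derive_flipped (is_derive_pprim2 (c - x) q1).
  apply: (@is_derive_eq _ _ _ _ _ _ _ _ (is_deriveZ q (is_deriveN D1))).
  by rewrite opprK.
have Dg x : is_derive x 1 g (m * q * pprim s (c - x) + M * (1 - q / s)).
  have D1 := is_derive_flipped (is_derive_pprim2 (c - x) s1).
  apply: (@is_derive_eq _ _ _ _ _ _ _ _ (is_deriveD
    (is_deriveZ (m * q) (is_deriveN D1))
    (is_deriveZ (M * (1 - q / s)) (is_derive_id x 1)))).
  by rewrite opprK /GRing.scale/= mulr1.
have := le_itv_diff l0 Df Dg (fun x => young_pprim _ (lt_trans ltr01 q1) qs M0).
rewrite /f /g /edge_energy !subr0; move: (M * (1 - q / s)) => B.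
by rewrite -!mulrA !(mulrN, mulrBr, mulrDr, mulr0); lra.
Qed.

Lemma edge_energy_ge0 q c l : 1 < q -> 0 <= l -> 0 <= edge_energy q c l.
Proof.
move=> q1 l0.
have Df x : is_derive x 1 (fun y => - pprim2 q (c - y)) (pprim q (c - x)).
  have D1 := is_derive_flipped (is_derive_pprim2 (c - x) q1).
  by apply: (@is_derive_eq _ _ _ _ _ _ _ _ (is_deriveN D1)); rewrite opprK.
have := le_itv_diff l0 (is_derive_cst (0 : R) ^~ 1) Df (fun x => pprim_ge0 _ q1).
by rewrite /edge_energy /cst !subr0; lra.
Qed.

End EdgeEnergy.

(** * Solving the torsion equation on one edge *)

Section EdgeProfile.
Context {R : realType}.
Implicit Types (b c l p q x y : R) (w f : R -> R).

Lemma conj_exp_gt1 p q : 1 < p -> p^-1 + q^-1 = 1 -> 1 < q.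
Proof.
move=> p1 pq; have p0 : 0 < p by lra.
have qV : q^-1 = 1 - p^-1 by lra.
have pV1 : p^-1 < 1 by rewrite invf_lt1.
have pV0 : 0 < p^-1 by rewrite invr_gt0.
by rewrite -invf_lt1 -1?invr_gt0 qV; lra.
Qed.

Lemma eq_derive0_itv f l : {within `[0, l], continuous f} ->
  (forall x, x \in `]0, l[ -> is_derive x 1 f 0) ->
  forall x, x \in `[0, l] -> f x = f 0.
Proof.
move=> cf Df x; rewrite inE/= in_itv/= => /andP[x0 xl].
have Dfx y : y \in `]0, x[%R -> is_derive y 1 f 0.
  rewrite in_itv/= => /andP[y0 yx]; apply: Df.
  by rewrite inE/= in_itv/= y0 (lt_le_trans yx).
have cfx : {within `[0, x], continuous f}.
  by apply: continuous_subspaceW cf; apply: subset_itvl; rewrite bnd_simp.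
have [c _] := MVT_segment x0 Dfx cfx.
by rewrite mul0r => /subr0_eq.
Qed.

(** Assumes no continuity at 0 and l: it is applied to the flux, about whose endpoint behaviour
    nothing is known yet. *)
Lemma eq_derive0_oo f l :
  (forall x, x \in `]0, l[ -> is_derive x 1 f 0) ->
  forall x y, x \in `]0, l[ -> y \in `]0, l[ -> f x = f y.
Proof.
move=> Df.
suff H x y : x \in `]0, l[ -> y \in `]0, l[ -> x <= y -> f x = f y.
  move=> x y xl yl; have [xy|/ltW yx] := leP x y; first exact: H.
  by rewrite (H y x).
rewrite !inE/= !in_itv/= => /andP[x0 xl] /andP[y0 yl] xy.
have Dxy z : z \in `[x, y]%R -> is_derive z 1 f 0.
  rewrite in_itv/= => /andP[xz zy]; apply: Df.
  by rewrite inE/= in_itv/= (lt_le_trans x0)//= (le_lt_trans zy).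
have cf : {within `[x, y], continuous f}.
  by apply: derivable_within_continuous => z /Dxy[].
have Dxyo z : z \in `]x, y[%R -> is_derive z 1 f 0.
  by move=> zxy; apply: Dxy; exact: subset_itv_oo_cc zxy.
have [c _] := MVT_segment xy Dxyo cf.
by rewrite mul0r => /subr0_eq.
Qed.

Lemma continuous_flipped f c : continuous f -> continuous (fun y => f (c - y)).
Proof.
move=> cf x; apply: (@continuous_comp _ _ _ (fun y => c - y) f); last exact: cf.
by apply: cvgB; [exact: cvg_cst | exact: cvg_id].
Qed.

Lemma continuous_profile q c b : 1 < q ->
  continuous (fun y => b - pprim q (c - y)).
Proof.
move=> q1 x; apply: cvgB; first exact: cvg_cst.
exact: (continuous_flipped (continuous_pprim q1)).
Qed.

(** The flux has derivative -1, so it is c - x; inverting it by [pfluxK] gives w' =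
    [pflux q (c - x)], and one more integration gives w. *)
Lemma edge_profile p q l w : 1 < p -> p^-1 + q^-1 = 1 -> 0 < l ->
  {within `[0, l], continuous w} ->
  (forall x, x \in `]0, l[ -> derivable w x 1 /\
     is_derive x 1 (fun y => - pflux p (derive1 w y)) 1) ->
  exists c b, forall x, x \in `[0, l] -> w x = b - pprim q (c - x).
Proof.
move=> p1 pq l0 cw Dw; have q1 := conj_exp_gt1 p1 pq.
have qp : q^-1 + p^-1 = 1 by rewrite addrC.
(* The constant is read off at the midpoint, an arbitrary interior point. *)
pose c := pflux p (derive1 w (l / 2)) + l / 2.
have fluxE x : x \in `]0, l[ -> derive1 w x = pflux q (c - x).
  move=> xl; rewrite -[LHS](pfluxK (derive1 w x) q1 qp); congr pflux.
  have D y : y \in `]0, l[ ->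
      is_derive y 1 (fun y => - pflux p (derive1 w y) - y) 0.
    move=> /Dw[_ D]; apply: (is_derive_eq (is_deriveB D (is_derive_id y 1))).
    by rewrite subrr.
  have := @eq_derive0_oo _ l D x (l / 2) xl.
  have -> : l / 2 \in `]0, l[%classic by rewrite inE/= in_itv/=; lra.
  by move=> /(_ isT); rewrite /c; lra.
have D0 x : x \in `]0, l[ -> is_derive x 1 (fun y => w y + pprim q (c - y)) 0.
  move=> xl; have [dw _] := Dw x xl.
  have D1 := is_derive_flipped (is_derive_pprim (c - x) q1).
  have D2 : is_derive x 1 w (pflux q (c - x)).
    by apply: DeriveDef => //; rewrite -derive1E fluxE.
  by apply: (is_derive_eq (is_deriveD D2 D1)); rewrite subrr.
exists c, (w 0 + pprim q c) => x xl.
have cc : {within `[0, l], continuous (fun y => w y + pprim q (c - y))}.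
  apply/subspace_continuousP => y yl; apply: cvgD.
    by move/subspace_continuousP : cw; exact.
  by apply: cvg_within_filter; exact: (continuous_flipped (continuous_pprim q1)).
by have := eq_derive0_itv cc D0 xl; rewrite subr0 => <-; rewrite addrK.
Qed.

Lemma cvg_onesided_derive f x (s : bool) df : is_derive x 1 f df ->
  (f (x + (-1) ^+ s * t) - f x) / t @[t --> 0^'+] --> (-1) ^+ s * df.
Proof.
move=> Df.
pose g (t : R) := f (x + (-1) ^+ s * t).
have Dg : is_derive (0 : R) 1 g ((-1) ^+ s * df).
  have D1 : is_derive (0 : R) 1 (fun t => x + (-1) ^+ s * t) ((-1) ^+ s).
    apply: (is_derive_eq (is_deriveD (is_derive_cst x (0 : R) 1)
              (is_deriveZ ((-1) ^+ s) (is_derive_id (0 : R) (1 : R))))).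
    by rewrite add0r /GRing.scale/= mulr1.
  rewrite mulrC; apply: (@is_derive1_comp _ f (fun t => x + (-1) ^+ s * t)) D1.
  by rewrite mulr0 addr0.
have [dg gE] := Dg.
have H : h^-1 *: ((g \o shift 0) (h *: (1 : R)) - g 0) @[h --> 0^'] --> (-1) ^+ s * df.
  by rewrite -gE; exact: dg.
have H2 : h^-1 *: ((g \o shift 0) (h *: (1 : R)) - g 0) @[h --> 0^'+] --> (-1) ^+ s * df.
  exact: cvg_dnbhs_at_right H.
apply: cvg_trans H2; apply: near_eq_cvg; near=> t.
by rewrite /g /= /GRing.scale/= mulr1 mulr0 !addr0 mulrC.
Unshelve. all: by end_near. Qed.

Lemma Rintegral_profile q c b l : 1 < q -> 0 < l ->
  \int[lebesgue_measure]_(x in `[0, l]) (b - pprim q (c - x)) =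
  b * l - edge_energy q c l.
Proof.
move=> q1 l0.
pose F y := b * y + pprim2 q (c - y).
have DF x : is_derive x 1 F (b - pprim q (c - x)).
  have D1 := is_derive_flipped (is_derive_pprim2 (c - x) q1).
  apply: (is_derive_eq (is_deriveD (is_deriveZ b (is_derive_id x 1)) D1)).
  by rewrite /GRing.scale/= mulr1.
have cF : continuous F.
  move=> x; apply/differentiable_continuous/derivable1_diffP.
  by case: (DF x).
rewrite /Rintegral (@continuous_FTC2 _ _ F)//.
- by rewrite /F /edge_energy subr0 /=; ring.
- by apply: continuous_subspaceT; exact: continuous_profile.
- split=> [x _||]; first by case: (DF x).
  + by apply: cvg_at_right_filter; exact: cF.
  + by apply: cvg_at_left_filter; exact: cF.
- by move=> x _; rewrite derive1E; case: (DF x).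
Qed.

End EdgeProfile.

(** * Kirchhoff fluxes on the graph: duality, minimality and the power mean inequality *)

Section Fluxes.
Context {R : realType} (G : metric_graph R).
Implicit Types (p q r s : R) (D : {set vertex G}) (u : graph_fun G).
Implicit Types (b c d : edge G -> R) (y : vertex G -> R).

(* The flux |u'|^(p-2) u' of a torsion function is [c e - x] along [e]; these
   are the Kirchhoff conditions for such a flux. *)
Definition torsion_flux D c : Prop := forall v, v \notin D ->
  \sum_(h in incident v) (-1) ^+ h.2 * (c h.1 - end_coord h.1 h.2) = 0.

(** With q conjugate to p, this is the shape of a function whose p-flux is [c e - x] on e; [b e] is
    the constant of integration. *)
Definition has_profile q c b u : Prop :=
  forall e (x : R), x \in `[0, edge_length e] -> on_edge u e x = b e - pprim q (c e - x).

(** Its product with q is the q-th power of the L^q norm of the flux. *)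
Definition total_energy q c : R :=
  \sum_(e : edge G) edge_energy q (c e) (edge_length e).

(** Every pair of an edge and an endpoint sits at exactly one vertex, so loops need no special
    treatment. *)
Lemma sum_edge_ends (f : edge G * bool -> R) :
  \sum_(e : edge G) (f (e, false) + f (e, true)) =
  \sum_(v : vertex G) \sum_(h in incident v) f h.
Proof.
transitivity (\sum_(h : edge G * bool) f h).
  transitivity (\sum_(e : edge G) \sum_(s : bool) f (e, s)).
    by apply: eq_bigr => e _; rewrite big_bool addrC.
  by rewrite pair_bigA; apply: eq_bigr => -[].
rewrite (partition_big (fun h : edge G * bool => edge_end h.1 h.2) predT)//=.
by apply: eq_bigr => v _; apply: eq_bigl => h; rewrite !inE.
Qed.

(** Regrouped by vertices, the sum has at v the term [y v] times the Kirchhoff sum; one factor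
    vanishes on D, the other off D. *)
Lemma torsion_flux_potential D c y : torsion_flux D c ->
  (forall v, v \in D -> y v = 0) ->
  \sum_(e : edge G) (c e * y (edge_end e false) -
    (c e - edge_length e) * y (edge_end e true)) = 0.
Proof.
move=> Kc y0.
pose f (h : edge G * bool) :=
  (-1) ^+ h.2 * (c h.1 - end_coord h.1 h.2) * y (edge_end h.1 h.2).
transitivity (\sum_(e : edge G) (f (e, false) + f (e, true))).
  by apply: eq_bigr => e _; rewrite /f /end_coord /= expr0 expr1; ring.
rewrite sum_edge_ends big1// => v _.
have -> : \sum_(h in incident v) f h =
    (\sum_(h in incident v) (-1) ^+ h.2 * (c h.1 - end_coord h.1 h.2)) * y v.
  by rewrite mulr_suml; apply: eq_bigr => h; rewrite inE => /eqP <-.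
by have [/y0 ->|/Kc ->] := boolP (v \in D); rewrite ?mulr0 ?mul0r.
Qed.

Lemma normal_derivative_profile q c b u (h : edge G * bool) : 1 < q ->
  has_profile q c b u ->
  normal_derivative u h = (-1) ^+ h.2 * pflux q (c h.1 - end_coord h.1 h.2).
Proof.
case: h => e s /= q1 /(_ e) Hu; rewrite /normal_derivative /=.
set z := end_coord e s; have l0 := edge_length_gt0 e.
(* The profile formula is differentiable across the endpoint, and [on_edge] agrees with it for 0 < t
   < [edge_length e]. *)
have Df : is_derive z 1 (fun x => b e - pprim q (c e - x)) (pflux q (c e - z)).
  have D1 := is_derive_flipped (is_derive_pprim (c e - z) q1).
  apply: (is_derive_eq (is_deriveB (is_derive_cst (b e) z 1) D1)).
  by rewrite sub0r opprK.
apply: cvg_lim => //.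
apply: cvg_trans (cvg_onesided_derive (s := s) Df).
apply: near_eq_cvg; near=> t.
have t0 : 0 < t by [].
have tl : t < edge_length e by near: t; exact: nbhs_right_lt.
rewrite !Hu// inE/= in_itv/= /z /end_coord; case: (s); rewrite ?expr1 ?expr0; lra.
Unshelve. all: by end_near. Qed.

Lemma torsion_has_profile p q D u : 1 < p -> p^-1 + q^-1 = 1 ->
  is_torsion_function p D u ->
  exists c b, torsion_flux D c /\ has_profile q c b u.
Proof.
move=> p1 pq [[[Su _] _] Du Ku]; have q1 := conj_exp_gt1 p1 pq.
have /choice[c Hc] : forall e, exists c0 b0 : R, forall x : R,
    x \in `[0, edge_length e] -> on_edge u e x = b0 - pprim q (c0 - x).
  move=> e; apply: (edge_profile p1 pq (edge_length_gt0 e)); last exact: Du.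
  by case: (Su e).
have /choice[b Hb] := Hc.
exists c, b; split=> // v vD; rewrite -[RHS](Ku v vD).
apply: eq_bigr => h _; rewrite (normal_derivative_profile _ q1 Hb).
by case: h.2; rewrite ?expr0 ?mul1r ?expr1 ?mulN1r ?pfluxN pfluxK.
Qed.

Lemma integral_graph_profile q c b u : 1 < q -> has_profile q c b u ->
  integral_graph u =
  \sum_(e : edge G) b e * edge_length e - total_energy q c.
Proof.
move=> q1 Hu; rewrite /integral_graph /total_energy -sumrB.
apply: eq_bigr => e _; rewrite -Rintegral_profile ?edge_length_gt0//.
by apply: eq_Rintegral => x xe; rewrite Hu.
Qed.

(** This is [torsion_flux_potential] for d and the vertex values of u. The left-hand side does not
    involve d, so different admissible fluxes can be compared. *)
Lemma profile_flux_pairing q c b d D u : 1 < q -> has_profile q c b u ->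
  (forall e (i : bool), on_edge u e (end_coord e i) = at_vertex u (edge_end e i)) ->
  (forall v, v \in D -> at_vertex u v = 0) -> torsion_flux D d ->
  \sum_(e : edge G) b e * edge_length e =
  \sum_(e : edge G) (d e * pprim q (c e) -
     (d e - edge_length e) * pprim q (c e - edge_length e)).
Proof.
move=> q1 Hu Vu u0 Kd; apply/eqP; rewrite -subr_eq0 -sumrB; apply/eqP.
rewrite -[RHS](torsion_flux_potential Kd u0); apply: eq_bigr => e _.
have l0 := edge_length_gt0 e.
rewrite -!Vu /end_coord !Hu ?subr0; last 2 first.
- by rewrite inE/= in_itv/=; lra.
- by rewrite inE/= in_itv/=; lra.
by ring.
Qed.

(** Pairing the flux c of u with itself gives the integral; pairing it with another d and using
    [edge_energy_dual] gives minimality. *)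
Lemma integral_torsion p q D u : 1 < p -> p^-1 + q^-1 = 1 ->
  is_torsion_function p D u ->
  exists c, [/\ torsion_flux D c, integral_graph u = q * total_energy q c &
    forall d, torsion_flux D d -> total_energy q c <= total_energy q d].
Proof.
move=> p1 pq Tu; have q1 := conj_exp_gt1 p1 pq.
have [c [b [Kc Hu]]] := torsion_has_profile p1 pq Tu.
have [[[_ Vu] u0] _ _] := Tu.
have P d := profile_flux_pairing q1 Hu Vu u0 (d := d).
have Pc : \sum_(e : edge G) b e * edge_length e = (q + 1) * total_energy q c.
  rewrite (P _ Kc) /total_energy mulr_sumr.
  by apply: eq_bigr => e _; exact: edge_energy_self.
exists c; split => // [|d /P].
  by rewrite (integral_graph_profile q1 Hu) Pc; ring.
rewrite Pc => E.
suff : (q + 1) * total_energy q c <= total_energy q d + q * total_energy q c by lra.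
rewrite E /total_energy mulr_sumr -big_split; apply: ler_sum => e _.
by apply: edge_energy_dual => //; rewrite ltW// edge_length_gt0.
Qed.

Lemma total_energy_power_mean q s c : 1 < q -> q < s -> 0 < total_length G ->
  (q * total_energy q c) `^ q^-1 <=
  total_length G `^ (q^-1 - s^-1) * (s * total_energy s c) `^ s^-1.
Proof.
move=> q1 qs L0; set L := total_length G in L0 *.
have s1 : 1 < s by lra.
have q0 : 0 < q by lra.
have s0 : 0 < s by lra.
set A := q * total_energy q c; set S := s * total_energy s c.
have A_ge0 : 0 <= A.
  rewrite mulr_ge0 ?(ltW q0)// sumr_ge0// => e _.
  by rewrite edge_energy_ge0// ltW// edge_length_gt0.
have S_ge0 : 0 <= S.
  rewrite mulr_ge0 ?(ltW s0)// sumr_ge0// => e _.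
  by rewrite edge_energy_ge0// ltW// edge_length_gt0.
(* The case A = 0 is settled apart because M = A / L must be positive. *)
have [A0|A_neq0] := eqVneq A 0.
  by rewrite A0 powR0 ?invr_neq0 ?gt_eqF// mulr_ge0// powR_ge0.
have A0 : 0 < A by rewrite lt_neqAle eq_sym A_neq0.
pose M := A / L; have M0 : 0 < M by rewrite divr_gt0.
have H : A <= M `^ (1 - s / q) * (q / s) * S + M * (1 - q / s) * L.
  rewrite /A /S /total_energy /L /total_length !mulr_sumr -big_split/=.
  apply: ler_sum => e _.
  have := edge_energy_young (c e) q1 qs M0 (ltW (edge_length_gt0 e)).
  move=> /le_trans; apply; rewrite lerD2r le_eqVlt; apply/orP; left; apply/eqP.
  by field; rewrite gt_eqF.
(* Since M L = A, the additive term is (1 - q/s) A; absorbing it on the left leaves the common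
   factor q/s. *)
have {H} : A <= M `^ (1 - s / q) * S.
  have qs0 : 0 < q / s by rewrite divr_gt0.
  rewrite -(ler_pM2l qs0).
  have E : M * (1 - q / s) * L = A - q / s * A.
    by rewrite /M; field; rewrite !gt_eqF.
  by move: H; rewrite E; lra.
rewrite -(ler_pM2l (powR_gt0 (s / q - 1) M0)) [X in _ <= X]mulrA -powRD; last first.
  by rewrite (lt0r_neq0 M0) implybT.
rewrite (_ : s / q - 1 + (1 - s / q) = 0); last by ring.
rewrite powRr0 mul1r => H.
have {H} : M `^ (s / q) * L <= S.
  apply: le_trans H; rewrite (_ : s / q = s / q - 1 + 1); last by ring.
  rewrite powRD; last by rewrite (lt0r_neq0 M0) implybT.
  rewrite powRr1 ?(ltW M0)// addrK -mulrA (_ : M * L = A)//.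
  by rewrite /M divfK// gt_eqF.
(* Taking s-th roots and multiplying by L^(1/q - 1/s) turns the left-hand side into (M L)^(1/q) =
   A^(1/q). *)
move=> /(ge0_ler_powR (_ : 0 <= s^-1)).
rewrite !nnegrE mulr_ge0 ?powR_ge0 ?(ltW L0)// invr_ge0 ltW// => /(_ isT isT S_ge0).
rewrite powRM ?powR_ge0 ?(ltW L0)// -powRrM (_ : s / q * s^-1 = q^-1); last first.
  by field; rewrite !gt_eqF.
rewrite -(ler_pM2l (powR_gt0 (q^-1 - s^-1) L0)).
move=> /(le_trans _); apply.
rewrite mulrCA -powRD; last by rewrite (lt0r_neq0 L0) implybT.
by rewrite subrK -powRM ?divfK ?gt_eqF// ?(ltW L0) ?(ltW M0).
Qed.

End Fluxes.

(** * Lagrange multipliers for separable functions on an affine subspace *)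

Section ConstrainedCriticalPoint.
Context {R : realType}.
Implicit Types (n m : nat).

Lemma continuous_rV_sum n (F : 'I_n -> R -> R) : (forall j, continuous (F j)) ->
  continuous (fun c : 'rV[R]_n => \sum_j F j (c ord0 j)).
Proof.
move=> cF; apply: continuous_big => [|j _ c].
  exact: add_continuous.
apply: (@continuous_comp _ _ _ (fun c : 'rV[R]_n => c ord0 j) (F j)).
  exact: coord_continuous.
exact: cF.
Qed.

Lemma closed_affine_subspace n m (A : 'M[R]_(n, m)) (b : 'rV_m) :
  closed [set c : 'rV[R]_n | c *m A = b].
Proof.
rewrite (_ : mkset _ = \bigcap_k [set c : 'rV[R]_n | \sum_j c ord0 j * A j k = b ord0 k]).
  apply: closed_bigI => k _.
  have /continuous_closedP /(_ _ (@closed_eq _ (b ord0 k))) : continuous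
      (fun c : 'rV[R]_n => \sum_j c ord0 j * A j k); last exact.
  apply: (@continuous_rV_sum _ (fun j x => x * A j k)) => j x.
  by apply: cvgMr_tmp; exact: cvg_id.
apply/seteqP; split=> c /= cA.
  by move=> k _ /=; rewrite -cA mxE.
by apply/rowP => k; rewrite -(cA k I) mxE.
Qed.

(* A minimiser of [\sum_j F j (c 0 j)] on an affine subspace is a critical
   point; there the gradient kills the kernel of the constraints, hence is in
   the image of their transpose. *)
Lemma exists_critical_point n m (A : 'M[R]_(n, m)) (b : 'rV_m)
    (F dF : 'I_n -> R -> R) :
  (forall j (x : R), is_derive x 1 (F j) (dF j x)) -> (forall j x, 0 <= F j x) ->
  (forall j (K : R), exists M : R, forall x, F j x <= K -> `|x| <= M) ->
  (b <= A)%MS ->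
  exists (c : 'rV_n) (y : 'rV_m), c *m A = b /\
    forall j, dF j (c ord0 j) = \sum_k y ord0 k * A j k.
Proof.
move=> DF F0 coF /submxP[c0 c0A].
have cF j : continuous (F j).
  move=> x; apply/differentiable_continuous/derivable1_diffP.
  by case: (DF j x).
pose Phi (c : 'rV[R]_n) := \sum_j F j (c ord0 j).
have cPhi : continuous Phi by exact: continuous_rV_sum.
have /choice[M HM] := fun j => coF j (Phi c0).
(* All terms being nonnegative, a bound on [Phi] bounds each of them, so coercivity puts this
   sublevel set in a box. *)
pose S := [set c : 'rV[R]_n | c *m A = b] `&` [set c | Phi c <= Phi c0].
have cS : compact S.
  have cB : compact [set c : 'rV[R]_n | forall j, `[- M j, M j]%classic (c ord0 j)].
    by apply: (@rV_compact _ _ (fun j => `[- M j, M j]%classic)) => j; exact: segment_compact.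
  apply: (subclosed_compact _ cB).
    apply: closedI; first exact: closed_affine_subspace.
    by have /continuous_closedP clPhi := cPhi; exact: (clPhi _ (@closed_le _ (Phi c0))).
  move=> c [_ /= cc0] j /=; rewrite in_itv/= -ler_norml; apply: HM.
  apply: le_trans cc0; rewrite /Phi (bigD1 j)//= lerDl.
  by apply: sumr_ge0 => i _; exact: F0.
have S0 : S !=set0 by exists c0; split=> //=.
have [c] := EVT_min_rV S0 cS (continuous_subspaceT cPhi).
rewrite inE => -[/= cA cc0] cmin.
have {}cmin t : t *m A = b -> Phi c <= Phi t.
  move=> tA; have [tc0|/ltW c0t] := leP (Phi t) (Phi c0).
    by apply: cmin; rewrite inE.
  exact: le_trans cc0 c0t.
pose g := \row_j dF j (c ord0 j).
have crit (t : 'rV_n) : t *m A = 0 -> \sum_j g ord0 j * t ord0 j = 0.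
  move=> tA.
  pose h (s : R) := \sum_j F j (c ord0 j + s * t ord0 j).
  have Dh (s : R) : is_derive s 1 h
      (\sum_j dF j (c ord0 j + s * t ord0 j) * t ord0 j).
    rewrite (_ : h = \sum_j (fun s => F j (c ord0 j + s * t ord0 j))); last first.
      by apply/funext => z; rewrite /h fct_sumE.
    apply: is_derive_sum => j.
    apply: (@is_derive1_comp _ (F j) (fun s => c ord0 j + s * t ord0 j)).
    apply: (is_derive_eq (is_deriveD (is_derive_cst (c ord0 j) s 1)
      (is_deriveM (is_derive_id s (1 : R)) (is_derive_cst (t ord0 j) s 1)))).
    by rewrite /GRing.scale/= mulr0 mulr1 !add0r.
  have hmin (s : R) : h 0 <= h s.
    have -> : h 0 = Phi c by apply: eq_bigr => j _; rewrite mul0r addr0.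
    have -> : h s = Phi (c + s *: t) by apply: eq_bigr => j _; rewrite !mxE.
    by apply: cmin; rewrite mulmxDl cA -scalemxAl tA scaler0 addr0.
  have dh (s : R) : s \in `](- 1), 1[%R -> derivable h s 1 by case: (Dh s).
  have le11 : - 1 <= 1 :> R by lra.
  have in0 : (0 : R) \in `](- 1), 1[%R by rewrite in_itv/=; lra.
  have [_ h0] := derive1_at_min le11 dh in0 (fun s _ => hmin s).
  have [_] := Dh 0; rewrite h0 => /esym.
  under eq_bigr do rewrite mul0r addr0.
  by move=> E; rewrite -[RHS]E; apply: eq_bigr => j _; rewrite mxE.
have : (g <= A^T)%MS.
  rewrite submxE; apply/eqP/rowP => k; rewrite !mxE.
  (* Transposed columns of the cokernel of A^T are kernel directions of A, to which [crit]
     applies. *)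
  pose t := (col k (cokermx A^T))^T.
  have tA : t *m A = 0.
    by rewrite -[LHS]trmxK trmx_mul trmxK colE mulmxA mulmx_coker mul0mx trmx0.
  by rewrite -[RHS](crit t tA); apply: eq_bigr => j _; rewrite /t !mxE.
move=> /submxP[y gE]; exists c, y; split=> // j.
have := congr1 (fun B : 'rV_n => B ord0 j) gE; rewrite !mxE => ->.
by apply: eq_bigr => k _; rewrite mxE.
Qed.

End ConstrainedCriticalPoint.

(** * Existence of an optimal flux together with its vertex potential *)

Section FluxExistence.
Context {R : realType} (G : metric_graph R).
Implicit Types (q : R) (D : {set vertex G}) (v w : vertex G) (e : edge G).

(** This is [young_pflux] at the points 1 and -1, where the constant term is 1 - 1/q. *)
Lemma normr_le_pprim q (t : R) : 1 < q -> `|t| <= pprim q t + 1.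
Proof.
move=> q1; have q0 : 0 < q by lra.
have E s : `|s| = 1 -> pflux q s = s /\ pprim q s = q^-1.
  by move=> s1; rewrite /pflux /pprim s1 !powR1 !mul1r.
have H s : `|s| = 1 -> t * s <= pprim q t + 1.
  move=> /E[f1 p1]; have := young_pflux t s q1; rewrite f1 p1.
  rewrite (_ : (q - 1) * q^-1 = 1 - q^-1); last by field; rewrite gt_eqF.
  have : 0 < q^-1 by rewrite invr_gt0.
  by lra.
have := H 1; have := H (- 1); rewrite normrN normr1 mulr1 mulrN1.
move=> /(_ erefl) H1 /(_ erefl) H2.
by rewrite ler_norml; apply/andP; split; lra.
Qed.

Lemma edge_energy_coercive q (l K : R) : 1 < q -> 0 < l ->
  exists M : R, forall c, edge_energy q c l <= K -> `|c| <= M.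
Proof.
(* The energy is l times [pprim q z] for some z between c - l and c; hence |z| is at most K/l + 1,
   and c is within l of z. *)
move=> q1 l0; exists (K / l + 1 + l) => c cK.
have ab : c - l <= c by lra.
have cp : {within `[c - l, c], continuous (pprim2 q)}.
  by apply: continuous_subspaceT; exact: continuous_pprim2.
have [z zc E] := MVT_segment ab (fun z _ => is_derive_pprim2 z q1) cp.
have zK : pprim q z <= K / l.
  rewrite ler_pdivlMr//; apply: le_trans cK.
  by rewrite /edge_energy E opprB addrC subrK.
have cz : `|c - z| <= l.
  by move: zc; rewrite in_itv/= ler_norml; lra.
have := normr_le_pprim z q1; have := ler_normD (c - z) z; rewrite subrK.
by lra.
Qed.

Lemma sum_incident (f : edge G * bool -> R) v :
  \sum_(h in incident v) f h =
  \sum_(e : edge G) ((edge_end e false == v)%:R * f (e, false) +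
    (edge_end e true == v)%:R * f (e, true)).
Proof.
rewrite big_mkcond/=.
transitivity (\sum_(e : edge G) \sum_(s : bool) (edge_end e s == v)%:R * f (e, s)).
  rewrite pair_bigA; apply: eq_bigr => -[e s] _; rewrite inE/=.
  by case: (_ == _); rewrite ?mul1r ?mul0r.
by apply: eq_bigr => e _; rewrite big_bool addrC.
Qed.

Lemma sum_enum_rank (T : finType) (f : 'I_#|T| -> R) :
  \sum_k f k = \sum_(x : T) f (enum_rank x).
Proof. by rewrite (reindex _ (onW_bij _ (enum_rank_bij T))). Qed.

Lemma sum_delta (T : finType) (f : T -> R) (x : T) :
  \sum_(z : T) f z * (x == z)%:R = f x.
Proof.
rewrite (bigD1 x)//= eqxx mulr1 big1 ?addr0// => z.
by rewrite eq_sym => /negbTE ->; rewrite mulr0.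
Qed.

(** Follow a path from a vertex of D. This injectivity of the discrete gradient makes the Kirchhoff
    system solvable, by duality. *)
Lemma connected_potential_eq0 D (y : vertex G -> R) : connected_graph G ->
  (exists v, v \in D) -> (forall v, v \in D -> y v = 0) ->
  (forall e, y (edge_end e false) = y (edge_end e true)) ->
  forall v, y v = 0.
Proof.
move=> hG [v0 v0D] y0 ye v; rewrite -(y0 _ v0D).
have /connectP[s vs ->] := hG v0 v.
elim: s v0 {v0D} vs => //= w s IH v0.
move=> /andP[/existsP[e /existsP[i /andP[/eqP <- /eqP <-]]] ws].
by rewrite IH//; case: i {ws} => /=; rewrite ye.
Qed.

(** A critical point of the energy under the Kirchhoff constraints, with y made from the
    multipliers. The last clause lets one profile on e take the prescribed values at both ends. *)
Lemma exists_flux_potential q D : 1 < q -> connected_graph G ->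
  (exists v, v \in D) ->
  exists (c : edge G -> R) (y : vertex G -> R),
  [/\ torsion_flux D c, forall v, v \in D -> y v = 0 &
    forall e, y (edge_end e true) =
      y (edge_end e false) + pprim q (c e) - pprim q (c e - edge_length e)].
Proof.
move=> q1 hG hD0.
(* Signed incidence matrix with the columns of D set to zero; [beta] collects the part of the
   Kirchhoff sums independent of c. *)
pose a e v : R :=
  (v \notin D)%:R * ((edge_end e false == v)%:R - (edge_end e true == v)%:R).
pose A : 'M[R]_(#|edge G|, #|vertex G|) := \matrix_(j, k) a (enum_val j) (enum_val k).
pose beta v : R := - \sum_(e : edge G) (edge_end e true == v)%:R * edge_length e.
pose b : 'rV[R]_#|vertex G| := \row_k ((enum_val k \notin D)%:R * beta (enum_val k)).
pose F (j : 'I_#|edge G|) x := edge_energy q x (edge_length (enum_val j)).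
pose dF (j : 'I_#|edge G|) x := pprim q x - pprim q (x - edge_length (enum_val j)).
have aE e (y : vertex G -> R) : \sum_v y v * a e v =
    (edge_end e false \notin D)%:R * y (edge_end e false) -
    (edge_end e true \notin D)%:R * y (edge_end e true).
  transitivity (\sum_v ((v \notin D)%:R * y v) * (edge_end e false == v)%:R -
      \sum_v ((v \notin D)%:R * y v) * (edge_end e true == v)%:R).
    by rewrite -sumrB; apply: eq_bigr => v _; rewrite /a; ring.
  by rewrite !sum_delta.
have AE e v : A (enum_rank e) (enum_rank v) = a e v by rewrite mxE !enum_rankK.
have DF j (x : R) : is_derive x 1 (F j) (dF j x).
  have D1 := is_derive_pprim2 x q1.
  have D2 := is_derive_pprim2 (x - edge_length (enum_val j)) q1.
  have D3 : is_derive x 1 (fun z => z - edge_length (enum_val j)) 1.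
    apply: (is_derive_eq (is_deriveB (is_derive_id x (1 : R))
      (is_derive_cst (edge_length (enum_val j)) x 1))).
    exact: subr0.
  have := is_deriveB D1
    (@is_derive1_comp _ _ (fun z => z - edge_length (enum_val j)) _ _ _ D2 D3).
  by rewrite mulr1.
have F0 j x : 0 <= F j x by rewrite edge_energy_ge0// ltW// edge_length_gt0.
have coF j K : exists M : R, forall x, F j x <= K -> `|x| <= M.
  by apply: edge_energy_coercive => //; exact: edge_length_gt0.
have bA : (b <= A)%MS.
  rewrite submxE; apply/eqP/rowP => k; rewrite mxE [RHS]mxE.
  (* A cokernel column, cut off on D, has equal values at the two ends of each edge, so it vanishes;
     b is cut off on D too and is thus orthogonal to the column. *)
  pose z v := (v \notin D)%:R * cokermx A (enum_rank v) k.
  have z0 v : z v = 0.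
    apply: (connected_potential_eq0 hG hD0) => [{}v vD|e].
      by rewrite /z vD mul0r.
    apply/eqP; rewrite -subr_eq0 /z.
    rewrite -(aE e (fun v => cokermx A (enum_rank v) k)).
    have := congr1
      (fun M : 'M[R]_(#|edge G|, #|vertex G|) => M (enum_rank e) k) (mulmx_coker A).
    rewrite !mxE => E; rewrite -[X in _ == X]E sum_enum_rank; apply/eqP.
    by apply: eq_bigr => w _; rewrite AE mulrC.
  rewrite sum_enum_rank big1// => v _; rewrite mxE enum_rankK.
  by rewrite mulrAC; have := z0 v; rewrite /z => ->; rewrite mul0r.
have [c [y [cA Hy]]] := exists_critical_point DF F0 coF bA.
exists (fun e => c ord0 (enum_rank e)).
(* The sign changes because [a] takes the start of an edge minus its end, while the potential must
   rise from start to end. *)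
exists (fun v => - ((v \notin D)%:R * y ord0 (enum_rank v))); split.
- move=> v vD; rewrite sum_incident.
  have := congr1 (fun M : 'rV[R]_#|vertex G| => M ord0 (enum_rank v)) cA.
  rewrite !mxE sum_enum_rank enum_rankK vD mul1r => /eqP.
  rewrite -subr_eq0 opprK -big_split/= => /eqP E; rewrite -[RHS]E.
  apply: eq_bigr => e _; rewrite AE /a vD /end_coord /= expr0 expr1.
  by ring.
- by move=> v vD; rewrite vD mul0r oppr0.
- move=> e; have := Hy (enum_rank e); rewrite /dF enum_rankK sum_enum_rank.
  have -> : \sum_v y ord0 (enum_rank v) * A (enum_rank e) (enum_rank v) =
      \sum_v y ord0 (enum_rank v) * a e v.
    by apply: eq_bigr => v _; rewrite AE.
  by rewrite (aE e (fun v => y ord0 (enum_rank v))); lra.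
Qed.

End FluxExistence.

(** * Membership of smooth functions in the Sobolev space of an edge *)

Section SmoothSobolev.
Context {R : realType}.
Implicit Types (f g h phi : R -> R) (p l : R).

Lemma integrable_continuous_itv (h : R -> R) (l : R) (i : interval R) :
  continuous h -> [set` i] `<=` `[0, l] ->
  lebesgue_measure.-integrable [set` i] (EFin \o h).
Proof.
move=> ch il.
have hl : lebesgue_measure.-integrable `[0, l] (EFin \o h).
  apply: continuous_compact_integrable; first exact: segment_compact.
  exact: continuous_subspaceT.
by apply: integrableS hl.
Qed.

Lemma Rintegral_oo_cc h l : continuous h ->
  \int[lebesgue_measure]_(x in `]0, l[) h x =
  \int[lebesgue_measure]_(x in `[0, l]) h x.
Proof.
move=> ch; rewrite Rintegral_itv_bndo_bndc.
  rewrite Rintegral_itv_obnd_cbnd//.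
  by apply: (@integrable_continuous_itv _ l) => //; exact: subset_itv_oc_cc.
by apply: (@integrable_continuous_itv _ l) => //; exact: subset_itv_oo_cc.
Qed.

Lemma continuous_in_Lp p l h : 0 < p -> continuous h -> in_Lp p l h.
Proof.
move=> p0 ch; split.
  by apply: measurable_funTS; exact: continuous_measurable_fun.
have chp : continuous (fun x => `|h x| `^ p).
  move=> x; apply: (@continuous_comp _ _ _ h (fun s => `|s| `^ p)); first exact: ch.
  exact: continuous_normr_powR.
have /integrableP[_] : lebesgue_measure.-integrable `]0, l[
    (EFin \o (fun x => `|h x| `^ p)).
  by apply: (@integrable_continuous_itv _ l) => //; exact: subset_itv_oo_cc.
apply: le_lt_trans; apply: ge0_le_integral => //=.
- apply: measurable_funTS; apply/measurable_EFinP; exact: continuous_measurable_fun.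
- apply: measurable_funTS; apply/measurable_EFinP; apply: continuous_measurable_fun => x.
  exact: (cvg_comp _ _ (chp x) (@norm_continuous _ _ (`|h x| `^ p))).
- by move=> x _; rewrite lee_fin ler_norm.
Qed.

Lemma C1_weak_derivative l f g : 0 < l ->
  (forall x : R, is_derive x 1 f (g x)) -> continuous g -> weak_derivative l f g.
Proof.
move=> l0 Df cg phi [dphi _ sphi].
have derivable_cont h : (forall x : R, derivable h x 1) -> continuous h.
  by move=> dh x; apply/differentiable_continuous/derivable1_diffP.
have derivable_LR h : (forall x : R, derivable h x 1) -> derivable_oo_LRcontinuous h 0 l.
  move=> dh; split=> [x _||]; first exact: dh.
  + by apply: cvg_at_right_filter; exact: derivable_cont.
  + by apply: cvg_at_left_filter; exact: derivable_cont.
have d0 (x : R) : derivable phi x 1 by exact: (dphi 0%N).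
have d1 (x : R) : derivable (derive1 phi) x 1 by exact: (dphi 1%N).
have df (x : R) : derivable f x 1 by case: (Df x).
(* In particular [phi] vanishes at 0 and l, which removes the boundary terms of the integration by
   parts. *)
have phi0 (x : R) : ~ `]0, l[%classic x -> phi x = 0.
  move=> xl; apply/eqP/negPn/negP => px; apply: xl; apply: sphi.
  exact: subset_closure.
have cgphi : continuous (fun x => g x * phi x).
  by move=> x; apply: cvgM; [exact: cg | exact: (derivable_cont _ d0)].
have cfphi : continuous (fun x => f x * derive1 phi x).
  by move=> x; apply: cvgM; [exact: (derivable_cont _ df) | exact: (derivable_cont _ d1)].
rewrite (Rintegral_oo_cc _ cfphi) (Rintegral_oo_cc _ cgphi).
have fg : {in `]0, l[%R, derive1 f =1 g} by move=> x _; rewrite derive1E; case: (Df x).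
have IBP := Rintegration_by_parts l0 (continuous_subspaceT cg) (derivable_LR _ df) fg
  (continuous_subspaceT (derivable_cont _ d1)) (derivable_LR _ d0)
  (fun _ _ => erefl).
rewrite IBP (phi0 0) ?(phi0 l) ?mulr0 ?subrr ?sub0r//=.
- by rewrite in_itv/= ltxx andbF.
- by rewrite in_itv/= ltxx.
Qed.

End SmoothSobolev.

(** * Existence of the torsion function and comparison of two exponents *)

Section TorsionFunction.
Context {R : realType} (G : metric_graph R).
Implicit Types (p q r : R) (D : {set vertex G}).

Lemma sobolev1_profile p q b c (l : R) : 1 < p -> 1 < q -> 0 < l ->
  sobolev1 p l (fun x => b - pprim q (c - x)).
Proof.
move=> p1 q1 l0; have p0 : 0 < p by lra.
split; first by apply: continuous_subspaceT; exact: continuous_profile.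
  by apply: continuous_in_Lp => //; exact: continuous_profile.
exists (fun x => pflux q (c - x)).
  by apply: continuous_in_Lp => //; apply: continuous_flipped; exact: continuous_pflux.
apply: (C1_weak_derivative l0) => [x|]; last first.
  by apply: continuous_flipped; exact: continuous_pflux.
have D1 := is_derive_flipped (is_derive_pprim (c - x) q1).
apply: (is_derive_eq (is_deriveB (is_derive_cst b x 1) D1)).
by rewrite sub0r opprK.
Qed.

Lemma exists_torsion_function p D : 1 < p -> connected_graph G ->
  (exists v, v \in D) -> exists u : graph_fun G, is_torsion_function p D u.
Proof.
move=> p1 hG hD0; pose q := p / (p - 1).
have p0 : p != 0 by rewrite gt_eqF//; lra.
have pm1 : p - 1 != 0 by rewrite gt_eqF//; lra.
have pq : p^-1 + q^-1 = 1 by rewrite /q; field; rewrite p0 pm1.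
have q1 := conj_exp_gt1 p1 pq.
have [c [y [Kc y0 Hy]]] := exists_flux_potential q1 hG hD0.
(* Chosen so that the profile equals y at the end 0; the clause [Hy] then gives the value at the
   other end. *)
pose b e := y (edge_end e false) + pprim q (c e).
pose u : graph_fun G := (y, fun e x => b e - pprim q (c e - x)).
have Hu : has_profile q c b u by [].
have Dw e (x : R) : is_derive x 1 (on_edge u e) (pflux q (c e - x)).
  have D1 := is_derive_flipped (is_derive_pprim (c e - x) q1).
  apply: (is_derive_eq (is_deriveB (is_derive_cst (b e) x 1) D1)).
  by rewrite sub0r opprK.
exists u; split.
- split=> //; split=> [e|e [] /=].
  + by apply: sobolev1_profile => //; exact: edge_length_gt0.
  + by rewrite Hy.
  + by rewrite /b subr0 addrK.
- move=> e x _; split; first by case: (Dw e x).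
  rewrite (_ : (fun _ => _) = fun z => z - c e); last first.
    apply/funext => z; rewrite derive1E (derive_val (is_derive := Dw e z)).
    by rewrite pfluxK// opprB.
  apply: (is_derive_eq (is_deriveB (is_derive_id x (1 : R)) (is_derive_cst (c e) x 1))).
  exact: subr0.
- move=> v vD; rewrite -[RHS](Kc v vD).
  apply: eq_bigr => h _; rewrite (normal_derivative_profile _ q1 Hu).
  by case: h.2; rewrite ?expr0 ?mul1r ?expr1 ?mulN1r ?pfluxN pfluxK.
Qed.

(** Once a solution exists, [xget] does not fall back on its default, the zero function. *)
Lemma torsion_functionP p D : (exists u : graph_fun G, is_torsion_function p D u) ->
  is_torsion_function p D (torsion_function p D).
Proof. by move=> [u Hu]; exact: xgetI Hu. Qed.

(** A vertex of degree one supplies an edge; connectedness alone would allow a single vertex without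
    edges. *)
Lemma total_length_gt0 D : (exists v, v \in D) ->
  (forall v, v \in D -> degree v = 1%N) -> 0 < total_length G.
Proof.
move=> [v vD] /(_ v vD) deg1.
have /card_gt0P[h _] : (0 < #|incident v|)%N by rewrite -/(degree v) deg1.
rewrite /total_length (bigD1 h.1)//= ltr_pwDl ?edge_length_gt0//.
by apply: sumr_ge0 => e _; rewrite ltW// edge_length_gt0.
Qed.

Lemma torsional_rigidity_root p q D : 1 < p -> p^-1 + q^-1 = 1 ->
  torsional_rigidity G p D `^ p^-1 = integral_graph (torsion_function p D) `^ q^-1.
Proof.
move=> p1 pq; rewrite /torsional_rigidity -powRrM; congr powR.
by rewrite mulrBl mul1r divff ?gt_eqF//; lra.
Qed.

Lemma torsional_rigidity_le r p D : connected_graph G ->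
  (exists v, v \in D) -> (forall v, v \in D -> degree v = 1%N) ->
  1 < r -> r < p ->
  torsional_rigidity G p D `^ p^-1 <=
  total_length G `^ (r^-1 - p^-1) * torsional_rigidity G r D `^ r^-1.
Proof.
move=> hG hD0 hD1 r1 rp; have p1 : 1 < p by lra.
pose q t : R := t / (t - 1).
have conj t : 1 < t -> t^-1 + (q t)^-1 = 1.
  by move=> t1; rewrite /q; field; rewrite !gt_eqF//; lra.
have q1 t : 1 < t -> 1 < q t by move=> t1; exact: conj_exp_gt1 (conj t t1).
have qp0 : 0 < q p by have := q1 p p1; lra.
have qr0 : 0 < q r by have := q1 r r1; lra.
(* Conjugation reverses the order of the exponents. *)
have qpr : q p < q r.
  rewrite -ltf_pV2 ?posrE//.
  have : p^-1 < r^-1 by rewrite ltf_pV2 ?posrE//; lra.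
  by have := conj p p1; have := conj r r1; lra.
have expE : r^-1 - p^-1 = (q p)^-1 - (q r)^-1.
  by have := conj p p1; have := conj r r1; lra.
have E0 f : 0 <= q p * total_energy (q p) f.
  rewrite mulr_ge0 ?(ltW qp0)// sumr_ge0// => e _.
  by rewrite edge_energy_ge0 ?q1// ltW// edge_length_gt0.
have Tu t : 1 < t -> is_torsion_function t D (torsion_function t D).
  by move=> t1; apply: torsion_functionP; exact: exists_torsion_function.
have [c [_ Ic min_c]] := integral_torsion p1 (conj p p1) (Tu p p1).
have [d [Kd Id _]] := integral_torsion r1 (conj r r1) (Tu r r1).
have Ep := torsional_rigidity_root D p1 (conj p p1).
have Er := torsional_rigidity_root D r1 (conj r r1).
rewrite Ic in Ep; rewrite Id in Er.
rewrite [X in X <= _]Ep [X in _ <= _ * X]Er expE.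
(* The flux d of the r-torsion function competes in the minimum for p: the power mean inequality is
   applied to d, and minimality of c compares c with d. *)
apply: le_trans (total_energy_power_mean d (q1 p p1) qpr (total_length_gt0 hD0 hD1)).
apply: ge0_ler_powR; rewrite ?nnegrE ?invr_ge0 ?(ltW qp0) ?E0//.
by rewrite ler_pM2l ?min_c.
Qed.

End TorsionFunction.

Theorem proposition3p7 (R : realType) (G : metric_graph R) (L : R)
    (D : {set vertex G}) (hG : connected_graph G) (hL : total_length G = L)
    (hD0 : exists v, v \in D) (hD1 : forall v, v \in D -> degree v = 1%N) :
  (forall r p : R, 1 < r -> r < p ->
     torsional_rigidity G p D `^ (p^-1) <=
     L `^ (r^-1 - p^-1) * torsional_rigidity G r D `^ (r^-1)) /\
  (forall r p : R, 1 < r -> r <= p ->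
     L `^ (p^-1) * torsional_rigidity G p D `^ (p^-1) <=
     L `^ (r^-1) * torsional_rigidity G r D `^ (r^-1)).
Proof.
have H r p : 1 < r -> r < p -> torsional_rigidity G p D `^ (p^-1) <=
    L `^ (r^-1 - p^-1) * torsional_rigidity G r D `^ (r^-1).
  by rewrite -hL; exact: torsional_rigidity_le.
split; first exact: H.
move=> r p r1 rp; have [<-|rNp] := eqVneq r p; first exact: lexx.
have {rNp}rp : r < p by rewrite lt_neqAle rNp.
have L0 : L != 0 by rewrite -hL gt_eqF// (total_length_gt0 hD0 hD1).
(* The monotone form is the first inequality multiplied by L^(1/p). *)
have LE : L `^ r^-1 = L `^ p^-1 * L `^ (r^-1 - p^-1).
  by rewrite -powRD ?L0 ?implybT// subrKC.
rewrite [X in _ <= X * _]LE -[X in _ <= X]mulrA.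
exact: ler_wpM2l (powR_ge0 _ _) _ _ (H r p r1 rp).
Qed.
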